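(* Let $\nu$ be a non-atomic positive measure on $K$ and let $M\neq\{0\}$ be a finite-dimensional subspace of $L^1(K,\nu)$. Then $f\in L^1(K,\nu)$ has a strongly unique best approximant from $M$ if and only if the best approximation operator from $M$ is locally Lipschitz continuous at $f$. Furthermore, in this case $$\frac1{\gamma(f)}\le\sigma(f)\le\frac2{\gamma(f)},$$ where $\gamma(f)$ is the optimal strong uniqueness constant of $f$ and $\sigma(f)$ is the optimal local Lipschitz constant at $f$.
   Context: $K$ is a set, $\Sigma$ a $\sigma$-field of subsets of $K$, $\nu$ a positive measure on $\Sigma$; $L^1(K,\nu)$ is the space of real-valued $\nu$-measurable functions $f$ with $|f|$ integrable, with norm $\|f\|_1=\int_K|f|\,d\nu$. A best approximant to $f$ from $M$ is $m^*\in M$ with $\|f-m^*\|_1\le\|f-m\|_1$ for all $m\in M$. The element $m^*\in M$ is a strongly unique best approximant to $f$ if there is $\gamma>0$ with $\|f-m\|_1-\|f-m^*\|_1\ge\gamma\|m-m^*\|_1$ for all $m\in M$; $\gamma(f)$ is the largest such $\gamma$. The best approximation operator from $M$ is locally Lipschitz continuous at $f$ if $f$ has a unique best approximant $P_M(f)$ from $M$ and there is $\sigma>0$ with $\|P_M(f)-P_M(g)\|_1\le\sigma\|f-g\|_1$ for all $g\in L^1(K,\nu)$ and any best approximant $P_M(g)$ to $g$ from $M$; $\sigma(f)$ is the smallest such $\sigma$. *)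

(* Defs.v *)
From HB Require Import structures.
From mathcomp Require Import all_boot all_order all_algebra.
From mathcomp Require Import all_classical all_reals all_analysis.

Set Implicit Arguments.
Unset Strict Implicit.
Unset Printing Implicit Defensive.

Import Order.TTheory GRing.Theory Num.Theory.
Import numFieldNormedType.Exports.

Local Open Scope classical_set_scope.
Local Open Scope ring_scope.

(* An atom is a set of positive measure that cannot be split into two
   measurable pieces of positive measure. On sets of finite measure,
   nu (A `\` B) = 0 is the same as nu B = nu A. *)
Definition is_atom (d : measure_display) (K : measurableType d) (R : realType)
    (nu : {measure set K -> \bar R}) (A : set K) : Prop :=
  [/\ measurable A, (0 < nu A)%E &
      forall B : set K, measurable B -> B `<=` A ->
        nu B = 0%E \/ nu (A `\` B) = 0%E].

Definition non_atomic (d : measure_display) (K : measurableType d)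
    (R : realType) (nu : {measure set K -> \bar R}) : Prop :=
  forall A : set K, ~ is_atom nu A.

(* The library's quotient type LspaceType carries no vector space structure, so
   L^1(K, nu) is represented by the lmodType of integrable functions, and
   equality in L^1(K, nu) is written out as equality nu-almost everywhere. *)
Definition L1 (d : measure_display) (K : measurableType d) (R : realType)
    (nu : {measure set K -> \bar R}) := LfunType nu (lexx (1%E : \bar R)).

Section best_approximation.
Context (d : measure_display) (K : measurableType d) (R : realType).
Variable nu : {measure set K -> \bar R}.
Implicit Types (f g m : L1 nu) (M : {pred L1 nu}).

Definition norm1 f : R := fine ('N[nu]_1[EFin \o f])%E.

(* The classes of the elements of M form a finite-dimensional linear subspace
   of L^1(K, nu). M need not be closed under almost everywhere equality: the
   notions below only depend on the set of classes of its elements. *)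
Definition fin_dim_subspace M : Prop :=
  submod_closed M /\
  exists (n : nat) (phi : 'I_n -> L1 nu),
    (forall i, phi i \in M) /\
    forall m, m \in M -> exists c : 'I_n -> R,
      (m : K -> R) = (\sum_(i < n) c i *: phi i : L1 nu) %[ae nu].

Definition nonzero_subspace M : Prop :=
  exists m, m \in M /\ ~ ((m : K -> R) = (0 : L1 nu) %[ae nu]).

Definition best_approximant M f m0 : Prop :=
  m0 \in M /\ forall m, m \in M -> norm1 (f - m0) <= norm1 (f - m).

Definition unique_best_approximant M f m0 : Prop :=
  best_approximant M f m0 /\
  forall m, best_approximant M f m -> (m : K -> R) = m0 %[ae nu].

Definition strong_uniqueness_bound M f m0 (gamma : R) : Prop :=
  0 < gamma /\
  forall m, m \in M ->
    norm1 (f - m) - norm1 (f - m0) >= gamma * norm1 (m - m0).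

Definition strongly_unique_best_approximant M f m0 : Prop :=
  m0 \in M /\ exists gamma : R, strong_uniqueness_bound M f m0 gamma.

Definition lipschitz_bound M f pf (sigma : R) : Prop :=
  0 < sigma /\
  forall g pg, best_approximant M g pg ->
    norm1 (pf - pg) <= sigma * norm1 (f - g).

Definition locally_lipschitz_at M f : Prop :=
  exists pf, unique_best_approximant M f pf /\
    exists sigma : R, lipschitz_bound M f pf sigma.

Definition strong_uniqueness_constants M f : set R :=
  [set gamma | exists m0, m0 \in M /\ strong_uniqueness_bound M f m0 gamma].

Definition local_lipschitz_constants M f : set R :=
  [set sigma | exists pf, unique_best_approximant M f pf /\
                          lipschitz_bound M f pf sigma].

(* gamma = gamma(f) *)
Definition optimal_strong_uniqueness_constant M f (gamma : R) : Prop :=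
  strong_uniqueness_constants M f gamma /\
  ubound (strong_uniqueness_constants M f) gamma.

(* sigma = sigma(f) *)
Definition optimal_local_lipschitz_constant M f (sigma : R) : Prop :=
  local_lipschitz_constants M f sigma /\
  lbound (local_lipschitz_constants M f) sigma.

End best_approximation.

(* Main.v *)
Require Import Defs.
From HB Require Import structures.
From mathcomp Require Import all_boot all_order all_algebra.
From mathcomp Require Import all_classical all_reals all_analysis.
From mathcomp Require Import measurable_realfun ring lra.

Set Implicit Arguments.
Unset Strict Implicit.
Unset Printing Implicit Defensive.

Import Order.TTheory GRing.Theory Num.Theory.
Import numFieldNormedType.Exports.

Local Open Scope classical_set_scope.
Local Open Scope ring_scope.

(* Let [p] be the best approximant to [f] and [m] in [M]. If a function [h] with
   values 1 and -1 annihilates [M] and satisfies [h (f - p) = |f - p|], then [m]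
   is a best approximant to the function [g] that equals [m] where
   [h (f - m) < 0] and [f] elsewhere, and
   [2 ||f - g|| = ||f - m|| - ||f - p||]. Hence a Lipschitz constant [sigma] gives
   the strong uniqueness constant [2 / sigma]; conversely a strong uniqueness
   constant [gamma] gives the Lipschitz constant [2 / gamma] by the triangle
   inequality.
   The existence of [h] is a consequence of Lyapunov's convexity theorem. Here
   it is enough to find, by splitting [K] into cells of small mass, an [h] that
   almost annihilates [M]: the defect disappears if moreover [g = m] on a small
   set that captures a fixed proportion of the norm of every element of [M]. *)

Section L1_best_approximation.
Context (d : measure_display) (K : measurableType d) (R : realType).
Variable nu : {measure set K -> \bar R}.
Implicit Types (u v w h : K -> R) (A B S T : set K).

Local Notation int1 u := (nu.-integrable setT (EFin \o u)).
Local Notation I u := (Rintegral nu setT u).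

(** * Integrals against multipliers bounded by one *)

Definition unit_mfun h := measurable_fun setT h /\ forall x, `|h x| <= 1.

Lemma unit_mfunM h1 h2 : unit_mfun h1 -> unit_mfun h2 -> unit_mfun (h1 \* h2).
Proof.
move=> [m1 b1] [m2 b2]; split; first exact: measurable_funM.
by move=> x /=; rewrite normrM mulr_ile1.
Qed.

Lemma unit_mfun_indic A : measurable A -> unit_mfun (\1_A : K -> R).
Proof.
move=> mA; split; first exact: measurable_indic.
by move=> x; rewrite indicE; case: (_ \in _); rewrite /= ?normr1 ?normr0.
Qed.

Lemma int1D u v : int1 u -> int1 v -> int1 (u \+ v).
Proof. by move=> iu iv; have := integrableD measurableT iu iv. Qed.

Lemma int1B u v : int1 u -> int1 v -> int1 (u \- v).
Proof. by move=> iu iv; have := integrableB measurableT iu iv. Qed.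

Lemma int1Z (a : R) u : int1 u -> int1 (fun x => a * u x).
Proof. by move=> iu; have := integrableZl measurableT a iu. Qed.

Lemma int1_norm u : int1 u -> int1 (fun x => `|u x|).
Proof. by move=> iu; have := integrable_norm iu. Qed.

Lemma int1_measurable u : int1 u -> measurable_fun setT u.
Proof. by move=> /integrableP[/measurable_EFinP]. Qed.

Lemma int1M h u : unit_mfun h -> int1 u -> int1 (h \* u).
Proof.
move=> [mh bh] iu; apply: (integrableMr measurableT mh _ iu).
exists 1; split => // y y1 x _ /=; exact: le_trans (bh x) (ltW y1).
Qed.

Lemma int1_Rint_sum (J : finType) (u : J -> K -> R) :
  (forall i, int1 (u i)) -> int1 (fun x => \sum_i u i x) /\
  I (fun x => \sum_i u i x) = \sum_i I (u i).
Proof.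
move=> iu; elim: (index_enum J) => [|i s [ihi ihI]].
  rewrite (_ : (fun x => _) = cst 0); last by apply/funext => x; rewrite big_nil.
  by rewrite big_nil Rintegral_cst// mul0r; split => //; exact: integrable0.
rewrite (_ : (fun x => _) = (u i \+ (fun x => \sum_(j <- s) u j x))); last first.
  by apply/funext => x /=; rewrite big_cons.
by rewrite big_cons -ihI; split; [exact: int1D|exact: RintegralD].
Qed.

Lemma int1_sum (J : finType) (u : J -> K -> R) :
  (forall i, int1 (u i)) -> int1 (fun x => \sum_i u i x).
Proof. by move=> /int1_Rint_sum[]. Qed.

Lemma Rint_sum (J : finType) (u : J -> K -> R) :
  (forall i, int1 (u i)) -> I (fun x => \sum_i u i x) = \sum_i I (u i).
Proof. by move=> /int1_Rint_sum[]. Qed.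

Lemma Rint_norm_le h u : unit_mfun h -> int1 u -> `|I (h \* u)| <= I (fun x => `|u x|).
Proof.
move=> uh iu; apply: le_trans (le_normr_Rintegral _ _) _ => //; first exact: int1M.
apply: le_Rintegral => //; [exact/int1_norm/int1M|exact: int1_norm|].
by move=> x _; rewrite normrM ler_piMl//; case: uh.
Qed.

Lemma Rint_ae_eq u v : measurable_fun setT u -> measurable_fun setT v ->
  u = v %[ae nu] -> I u = I v.
Proof.
move=> mu mv uv; congr fine; apply: ae_eq_integral => //; try exact/measurable_EFinP.
by apply: filterS uv => x /[apply] ->.
Qed.

Lemma Rint_eq0 u : int1 u -> (forall x, 0 <= u x) -> I u = 0 -> u = cst 0 %[ae nu].
Proof.
move=> iu u0 Iu0.
have mu : measurable_fun setT (EFin \o u) by case/integrableP: iu.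
have /(ae_eq_integral_abs nu measurableT mu) : (\int[nu]_x `|(EFin \o u) x| = 0)%E.
  under eq_integral do rewrite gee0_abs ?lee_fin//.
  by rewrite -[LHS]fineK ?integrable_fin_num// -[fine _]/(I u) Iu0.
by apply: filterS => x /(_ Logic.I) [->].
Qed.

Lemma indic_setU_disjoint A B : A `&` B = set0 ->
  \1_(A `|` B) = \1_A \+ \1_B :> (K -> R).
Proof.
move=> AB; apply/funext => x /=; rewrite !indicE !in_setU.
have [xA|xA] := boolP (x \in A); have [xB|xB] := boolP (x \in B);
  rewrite ?addr0 ?add0r//.
suff : set0 x by [].
by rewrite -AB; split; exact/set_mem.
Qed.

(** * Non-atomic measures *)

(** The measure with density [w] with respect to [nu]. It is finite for integrable [w] even if [nu]
    is not, so masses can be subtracted in [R]. *)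
Definition mass w A : R := I (\1_A \* w).

Section mass.
Variable w : K -> R.
Hypotheses (iw : int1 w) (w0 : forall x, 0 <= w x).

Let int1_mass A : measurable A -> int1 (\1_A \* w).
Proof. by move=> mA; apply: int1M => //; exact: unit_mfun_indic. Qed.

Lemma massU A B : measurable A -> measurable B -> A `&` B = set0 ->
  mass w (A `|` B) = mass w A + mass w B.
Proof.
move=> mA mB AB; rewrite /mass indic_setU_disjoint// -RintegralD//; last 2 first.
- exact: int1_mass.
- exact: int1_mass.
by congr (I _); apply/funext => x /=; rewrite mulrDl.
Qed.

Lemma mass_ge0 A : 0 <= mass w A.
Proof. by apply: Rintegral_ge0 => x _; rewrite /= mulr_ge0// indicE. Qed.

Lemma massD A B : measurable A -> measurable B -> B `<=` A ->
  mass w A = mass w B + mass w (A `\` B).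
Proof.
move=> mA mB BA; rewrite -massU//; first by rewrite setDUK.
  exact: measurableD.
by rewrite setDIK.
Qed.

Lemma le_mass A B : measurable A -> measurable B -> B `<=` A ->
  mass w B <= mass w A.
Proof. by move=> mA mB BA; rewrite (massD mA mB BA) lerDl mass_ge0. Qed.

Lemma mass_eq0 A : measurable A -> (forall x, A x -> 0 < w x) ->
  mass w A = 0 -> nu A = 0%E.
Proof.
move=> mA wA /Rint_eq0.
case.
- exact: int1_mass.
- by move=> x; rewrite /= mulr_ge0// indicE.
move=> N [mN N0 sN]; apply: (subset_measure0 _ _ _ N0) => // x Ax.
apply: sN => /= /(_ Logic.I) /eqP.
by rewrite indicE mem_set// mul1r gt_eqF// wA.
Qed.

Lemma mass_null A : measurable A -> nu A = 0%E -> mass w A = 0.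
Proof.
move=> mA A0; rewrite /mass (@Rint_ae_eq _ (cst 0)) ?Rintegral_cst ?mul0r//.
  exact/int1_measurable/int1_mass.
exists A; split => // x /= /not_implyP[_ xA]; apply: contrapT => nAx; apply: xA.
by rewrite indicE memNset// mul0r.
Qed.

Lemma mass_bigcap_cvg (A : nat -> set K) : (forall n, measurable (A n)) ->
  (forall n, A n.+1 `<=` A n) ->
  mass w \o A @ \oo --> mass w (\bigcap_n A n).
Proof.
move=> mA sA.
have mAoo : measurable (\bigcap_n A n) by exact: bigcapT_measurable.
have iA B : measurable B -> (\int[nu]_x (\1_B x * w x)%:E)%E \is a fin_num.
  by move=> mB; apply: integrable_fin_num => //; exact: int1_mass.
rewrite /mass /Rintegral; apply: fine_cvg; rewrite fineK ?iA//.
case: (@dominated_convergence _ _ _ nu setT measurableT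
   (fun n => EFin \o (\1_(A n) \* w)) (EFin \o (\1_(\bigcap_n A n) \* w))
   (EFin \o w) _ _ _ iw _) => //.
- by move=> n; have /integrableP[] := int1_mass (mA n).
- by have /integrableP[] := int1_mass mAoo.
- apply: nearW => x _.
  have [xA|/existsNP[n nxA]] := pselect (forall n, A n x).
    apply: cvg_near_cst; apply: nearW => n /=.
    by rewrite !indicE !mem_set//; move=> i _.
  apply: cvg_near_cst; exists n => // m /= nm.
  rewrite !indicE !memNset//; first by move=> /(_ n Logic.I).
  move=> Amx; apply: nxA; move: nm Amx => /subnK <-.
  by elim: (m - n)%N => [|k ih] //; rewrite addSn => /sA.
- apply: nearW => x n _ /=.
  by rewrite lee_fin normrM ger0_norm ?indicE//= (ger0_norm (w0 x)) ler_piMl// lern1 leq_b1.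
Qed.

End mass.

(** Finite disjoint unions of cells of mass at most [e]. The inductive form supplies the induction
    over cells on which vector balancing runs. *)
Inductive fine_set (w : K -> R) (e : R) : set K -> Prop :=
| fine_small A : measurable A -> mass w A <= e -> fine_set w e A
| fine_union A B : fine_set w e A -> fine_set w e B -> A `&` B = set0 ->
    fine_set w e (A `|` B).

Lemma fine_set_measurable w e A : fine_set w e A -> measurable A.
Proof. by elim=> // B C _ mB _ mC _; exact: measurableU. Qed.

(* Otherwise a decreasing sequence of non-fine sets of nearly minimal mass has
   a non-fine intersection of minimal mass, and this is an atom. *)
Lemma non_atomic_fine w e A : non_atomic nu -> int1 w -> (forall x, 0 <= w x) ->
  0 < e -> measurable A -> fine_set w e A.
Proof.
move=> atomless iw w0 e0 mA; apply: contrapT => nfA.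
pose bad B := measurable B /\ ~ fine_set w e B.
have bad_sub B C : bad B -> measurable C -> C `<=` B -> fine_set w e (B `\` C) ->
    bad C.
  move=> [mB nfB] mC CB fBC; split => // fC; apply: nfB.
  by rewrite -(setDUK CB); apply: fine_union => //; rewrite setDIK.
(* Greedy choice: inside a bad set, a bad subset whose mass is within [n.+1%:R^-1] of the infimum
   over bad subsets. *)
have next (Bn : set K * nat) : exists C, bad Bn.1 ->
    [/\ bad C, C `<=` Bn.1 & forall D, bad D -> D `<=` Bn.1 ->
      mass w C <= mass w D + Bn.2.+1%:R^-1].
  case: Bn => B n /=; have [bB|] := pselect (bad B); last by exists B.
  pose E := [set mass w D | D in [set D | bad D /\ D `<=` B]].
  have hE : has_inf E.
    split; first by exists (mass w B); exists B => //; split.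
    by exists 0 => _ [D _ <-]; exact: (mass_ge0 w0).
  have n0 : 0 < n.+1%:R^-1 :> R by rewrite invr_gt0 ltr0n.
  have [_ [C [bC CB] <-] Clt] := inf_adherent n0 hE.
  exists C => _; split => // D bD DB; apply: (le_trans (ltW Clt)).
  by rewrite lerD2r; apply: ge_inf; [case: hE|exists D].
have [F FP] := choice next.
pose S := fix S n := if n is m.+1 then F (S m, m) else A.
have bS n : bad (S n) by elim: n => [|n ih] //=; have [] := FP (S n, n) ih.
have sS n : S n.+1 `<=` S n by have [] := FP (S n, n) (bS n).
have mS n : measurable (S n) by case: (bS n).
set Soo := \bigcap_n S n.
have mSoo : measurable Soo by exact: bigcapT_measurable.
have SooS n : Soo `<=` S n by move=> x; exact.
(* For large [n], what [S n] has beyond [Soo] is a single small cell, and removing it from a bad set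
   leaves a bad set. *)
have bSoo : bad Soo.
  have /cvgrPdist_le /(_ e e0)[n _ /(_ n (leqnn n))] := mass_bigcap_cvg iw w0 mS sS.
  rewrite /= -/Soo (massD iw (mS n) mSoo (SooS n)) opprD addrA subrr add0r normrN => Sne.
  apply: (bad_sub (S n)) => //; apply: fine_small.
    exact: measurableD.
  by apply: le_trans Sne; exact: ler_norm.
have minSoo B : bad B -> B `<=` Soo -> mass w Soo <= mass w B.
  move=> bB BS; apply/ler_addgt0Pr => r r0.
  have [n rn] : exists n, n.+1%:R^-1 <= r.
    exists (Num.truncn r^-1); rewrite -[leRHS]invrK lef_pV2 ?posrE ?invr_gt0 ?ltr0n//.
    by rewrite ltW// truncnS_gt.
  have [_ _ /(_ B bB)] := FP (S n, n) (bS n).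
  move=> /(_ (subset_trans BS (SooS n))) /= SB.
  apply: (le_trans (le_mass iw w0 (mS n.+1) mSoo (SooS n.+1))).
  by apply: (le_trans SB); rewrite lerD2l.
(* Zero mass implies [nu]-nullity only where [w] is positive, so the atom is sought there; the
   restriction does not change masses. *)
pose A' := Soo `&` [set x | 0 < w x].
have mw : measurable [set x | 0 < w x].
  rewrite -[X in measurable X]setTI.
  by apply: measurable_fun_ltr => //; exact: int1_measurable iw.
have mA' : measurable A' by exact: measurableI.
have nullE C : measurable C -> C `<=` A' -> mass w C = 0 -> nu C = 0%E.
  by move=> mC CA' /(mass_eq0 iw w0 mC); apply => x /CA'[].
have A'E C : mass w (C `&` [set x | 0 < w x]) = mass w C.
  congr (I _); apply/funext => x /=; rewrite !indicE in_setI.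
  case: (ltrP 0 (w x)) => wx; first by rewrite [x \in [set _ | _]]mem_set// andbT.
  have -> : w x = 0 by apply/eqP; rewrite eq_le wx w0.
  by rewrite !mulr0.
apply: (atomless A'); split => //.
  rewrite lt0e measure_ge0 andbT; apply/eqP => A'0.
  apply: bSoo.2; apply: fine_small => //; by rewrite -A'E (mass_null iw) ?ltW.
move=> B mB BA'.
have BS : B `<=` Soo by move=> x /BA'[].
(* By minimality of [Soo]: if [B] is bad, the rest of [A'] has no mass; otherwise the complement of
   [B] in [Soo] is bad, and [B] has no mass. *)
have [bB|nbB] := pselect (bad B); [right|left].
  apply: nullE; [exact: measurableD|by move=> x []|].
  apply/eqP; rewrite eq_le mass_ge0// andbT.
  have := minSoo B bB BS; rewrite -A'E -/A' (massD iw mA' mB BA').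
  by rewrite gerDl.
apply: nullE => //.
apply/eqP; rewrite eq_le mass_ge0// andbT.
have bD : bad (Soo `\` B).
  apply: (bad_sub Soo) => //; [exact: measurableD|].
  rewrite setDD setIidr//.
  by apply: contrapT => nfB; apply: nbB.
have := minSoo _ bD (@subDsetl _ _ _); rewrite (massD iw mSoo mB BS).
by rewrite gerDr.
Qed.

(** * Approximate convexity of vector integrals *)

Lemma sum_sqr_le_sqr_sum (J : finType) (x : J -> R) :
  \sum_i x i ^+ 2 <= (\sum_i `|x i|) ^+ 2.
Proof.
rewrite [leRHS]expr2 mulr_sumr; apply: ler_sum => i _.
rewrite -real_normK ?num_real// expr2 ler_wpM2r// (bigD1 i)//= lerDl.
exact: sumr_ge0.
Qed.

Lemma sum_sqrD (J : finType) (a : R) (s x : J -> R) :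
  \sum_i (s i + a * x i) ^+ 2 =
  \sum_i s i ^+ 2 + 2 * a * \sum_i s i * x i + a ^+ 2 * \sum_i x i ^+ 2.
Proof. by rewrite !mulr_sumr -!big_split/=; apply: eq_bigr => i _; ring. Qed.

Section thinning.
Variables (J : finType) (u : J -> K -> R).
Hypothesis iu : forall i, int1 (u i).
Let w (x : K) : R := \sum_i `|u i x|.

Let iw : int1 w. Proof. by apply: int1_sum => i; exact: int1_norm. Qed.

Let w0 x : 0 <= w x. Proof. exact: sumr_ge0. Qed.

Lemma sum_sqr_Rint_le A : measurable A ->
  \sum_i I (\1_A \* u i) ^+ 2 <= mass w A ^+ 2.
Proof.
move=> mA; have uA := unit_mfun_indic mA.
apply: (le_trans (sum_sqr_le_sqr_sum _)).
rewrite ler_pXn2r ?nnegrE ?sumr_ge0 ?mass_ge0//.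
rewrite /mass (_ : \1_A \* w = (fun x => \sum_i `|(\1_A \* u i) x|)).
  rewrite Rint_sum; last by move=> i; exact/int1_norm/int1M.
  by apply: ler_sum => i _; apply: le_normr_Rintegral => //; exact: int1M.
apply/funext => x /=; rewrite mulr_sumr; apply: eq_bigr => i _.
by rewrite normrM indicE ger0_norm.
Qed.

(* Vector balancing: each small cell is put in or left out of [T] so that its
   contribution has a nonpositive scalar product with the current [s]. *)
Lemma fine_thinning (t e : R) A (s : J -> R) : 0 <= t <= 1 -> fine_set w e A ->
  exists T, [/\ measurable T, T `<=` A &
    \sum_i (s i + I (\1_T \* u i) - t * I (\1_A \* u i)) ^+ 2 <=
    \sum_i s i ^+ 2 + e * mass w A].
Proof.
move=> /andP[t0 t1] fA; elim: fA s => {A} [A mA Ae|A B fA ihA fB ihB AB] s.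
  have X := sum_sqr_Rint_le mA.
  have X2 : \sum_i I (\1_A \* u i) ^+ 2 <= e * mass w A.
    by apply: (le_trans X); rewrite expr2 ler_wpM2r// mass_ge0.
  have X0 : 0 <= \sum_i I (\1_A \* u i) ^+ 2 by apply: sumr_ge0 => i _; exact: sqr_ge0.
  have [sx|sx] := leP (\sum_i s i * I (\1_A \* u i)) 0.
    exists A; split => //.
    under eq_bigr do rewrite -addrA -[X in X - _]mul1r -mulrBl.
    rewrite sum_sqrD -addrA lerD2l; apply: le_trans X2.
    apply: ler_wnDl; last by rewrite ler_piMl// exprn_ile1// ?subr_ge0 ?gerBl.
    by rewrite mulr_ge0_le0// mulr_ge0 ?subr_ge0.
  exists set0; split => //.
  have I0 i : I (\1_set0 \* u i) = 0.
    rewrite (_ : _ \* _ = fun=> 0); first by rewrite Rintegral_cst// mul0r.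
    by apply/funext => x /=; rewrite indic0 mul0r.
  under eq_bigr do rewrite I0 addr0 -mulNr.
  rewrite sum_sqrD -addrA lerD2l; apply: le_trans X2.
  apply: ler_wnDl; last by rewrite ler_piMl// sqrrN expr_le1.
  by rewrite mulrN mulNr oppr_le0 !mulr_ge0// ltW.
have mA := fine_set_measurable fA; have mB := fine_set_measurable fB.
have [T1 [mT1 T1A sT1]] := ihA s.
have [T2 [mT2 T2B sT2]] := ihB (fun i => s i + I (\1_T1 \* u i) - t * I (\1_A \* u i)).
have T12 : T1 `&` T2 = set0.
  by apply/seteqP; split => // x [/T1A Ax /T2B Bx]; rewrite -AB.
have splitU C D i : measurable C -> measurable D -> C `&` D = set0 ->
    I (\1_(C `|` D) \* u i) = I (\1_C \* u i) + I (\1_D \* u i).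
  move=> mC mD CD; rewrite indic_setU_disjoint// -RintegralD//; last 2 first.
  - exact/int1M/iu/unit_mfun_indic.
  - exact/int1M/iu/unit_mfun_indic.
  by congr (I _); apply/funext => x /=; rewrite mulrDl.
exists (T1 `|` T2); split; [exact: measurableU|exact: setUSS|].
rewrite massU// mulrDr addrA; apply: (le_trans _ (le_trans sT2 _)).
  rewrite le_eqVlt; apply/orP; left; apply/eqP; apply: eq_bigr => i _.
  by rewrite !splitU//; congr (_ ^+ 2); ring.
by rewrite lerD2r.
Qed.

(** The set [T] imitates the constant multiplier [t]. Cells of mass at most [e / (mass w setT + 1)]
    keep the accumulated error below [e]; the 1 avoids a zero denominator. *)
Lemma thinning (t e : R) (s : J -> R) : non_atomic nu -> 0 <= t <= 1 -> 0 < e ->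
  exists2 T, measurable T &
    \sum_i (s i + I (\1_T \* u i) - t * I (u i)) ^+ 2 <= \sum_i s i ^+ 2 + e.
Proof.
move=> atomless t01 e0; have m0 := mass_ge0 w0 setT.
have e'0 : 0 < e / (mass w setT + 1) by rewrite divr_gt0// ltr_wpDl.
have [T [mT _ sT]] :=
  fine_thinning s t01 (non_atomic_fine atomless iw w0 e'0 measurableT).
exists T => //; apply: le_trans (le_trans sT _).
  rewrite le_eqVlt; apply/orP; left; apply/eqP; apply: eq_bigr => i _.
  rewrite (_ : \1_setT \* u i = u i)//.
  by apply/funext => x /=; rewrite indicT mul1r.
by rewrite lerD2l mulrAC ler_pdivrMr ?ltr_wpDl// ler_wpM2l// ?lerDl// ltW.
Qed.

Lemma thinning_norm (t e : R) : non_atomic nu -> 0 <= t <= 1 -> 0 < e ->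
  exists2 T, measurable T & forall i, `|I (\1_T \* u i) - t * I (u i)| <= e.
Proof.
move=> atomless t01 e0.
have [T mT sT] := thinning (fun=> 0) atomless t01 (exprn_gt0 2 e0).
exists T => // i; rewrite -ler_sqr ?nnegrE ?(ltW e0)// real_normK ?num_real//.
apply: le_trans (le_trans sT _).
  rewrite (bigD1 i)//= add0r lerDl; apply: sumr_ge0 => j _; exact: sqr_ge0.
by rewrite big1 ?add0r// => j _; rewrite expr0n.
Qed.

End thinning.

(** * Sign functions and their moments *)

Definition sign_fun h := measurable_fun setT h /\ forall x, h x = 1 \/ h x = -1.

Lemma sign_fun_unit h : sign_fun h -> unit_mfun h.
Proof. by move=> [mh sh]; split => // x; case: (sh x) => ->; rewrite ?normrN normr1. Qed.

Lemma sign_fun_ge0 u : measurable_fun setT u ->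
  sign_fun (fun x => if 0 <= u x then 1 else -1).
Proof.
move=> mu; split; last by move=> x; case: ifP; [left|right].
by apply: measurable_fun_ifT => //; exact: measurable_fun_ler.
Qed.

(* [L] belongs to the closure of the set [C] of the vectors [I (h \* u i)]: if
   [h] nearly minimizes the distance to [L], with difference [v], moving a
   proportion [t] of [h] towards the sign of [\sum_i v i * u i] stays within [C]
   by thinning, and reduces the distance. *)
Lemma sign_fun_moments (J : finType) (u : J -> K -> R) (L : J -> R) (e : R) :
  non_atomic nu -> (forall i, int1 (u i)) ->
  (forall v : J -> R, \sum_i L i * v i <= I (fun x => `|\sum_i v i * u i x|)) ->
  0 < e -> exists2 h, sign_fun h & \sum_i (L i - I (h \* u i)) ^+ 2 <= e.
Proof.
move=> atomless iu Lu e0.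
pose D h := \sum_i (L i - I (h \* u i)) ^+ 2.
pose E := [set D h | h in sign_fun].
have hE : has_inf E.
  split; first by exists (D (cst 1)), (cst 1) => //; split => //; left.
  by exists 0 => _ [h _ <-]; apply: sumr_ge0 => i _; exact: sqr_ge0.
have [ltde|] := ltP (inf E) e.
  have de : 0 < e - inf E by rewrite subr_gt0.
  have [_ [h sh <-]] := inf_adherent de hE.
  by rewrite subrKC => /ltW he; exists h.
set m := inf E => em; have m0 : 0 < m by exact: lt_le_trans em.
have minD h : sign_fun h -> m <= D h.
  by move=> sh; apply: ge_inf; [case: hE|exists h].
pose B := \sum_i (2 * I (fun x => `|u i x|)) ^+ 2.
have B0 : 0 <= B by apply: sumr_ge0 => i _; exact: sqr_ge0.
(* With [D h < m + t ^+ 2], the new squared distance is less than [m + t ^+ 2 - 2 * t * m + t ^+ 2 *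
   B + t ^+ 2], and [t * (B + 2) <= m] brings this down to [m - t * m]. *)
pose t := m / (B + 2 + m).
have den0 : 0 < B + 2 + m by rewrite ltr_wpDl// addr_ge0.
have t0 : 0 < t by rewrite divr_gt0.
have t1 : t <= 1 by rewrite ler_pdivrMr// mul1r lerDr addr_ge0.
have tB : t * (B + 2) <= m.
  by rewrite mulrAC ler_pdivrMr// ler_wpM2l ?(ltW m0)// lerDl ltW.
have [_ [h sh <-] hm] := inf_adherent (exprn_gt0 2 t0) hE.
pose v i := L i - I (h \* u i).
have ivu i : int1 (fun x => v i * u i x) by exact: int1Z.
pose k x : R := if 0 <= \sum_i v i * u i x then 1 else -1.
have sk : sign_fun k by apply/sign_fun_ge0/int1_measurable/int1_sum.
have ih i : int1 (h \* u i) by apply: int1M => //; exact: sign_fun_unit.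
have ik i : int1 (k \* u i) by apply: int1M => //; exact: sign_fun_unit.
pose u' i := (k \* u i) \- (h \* u i).
have iu' i : int1 (u' i) by exact: int1B.
have Iu' i : I (u' i) = I (k \* u i) - I (h \* u i) by exact: RintegralB.
have u'B : \sum_i I (u' i) ^+ 2 <= B.
  apply: ler_sum => i _; rewrite -[leLHS]real_normK ?num_real//.
  rewrite lerXn2r ?nnegrE ?mulr_ge0 ?Rintegral_ge0//.
  rewrite Iu' (le_trans (ler_normB _ _))// mulr_natl mulr2n lerD//;
    exact/Rint_norm_le/iu/sign_fun_unit.
(* Replacing [h] by the sign [k] turns [\sum_i v i * I (h \* u i)] into the integral of
   [|\sum_i v i * u i|], which by [Lu] is at least [\sum_i L i * v i]. *)
have vu' : D h <= \sum_i v i * I (u' i).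
  have -> : \sum_i v i * I (u' i) =
      I (fun x => `|\sum_i v i * u i x|) - \sum_i v i * I (h \* u i).
    under eq_bigr do rewrite Iu' mulrBr; rewrite sumrB; congr (_ - _).
    rewrite (eq_bigr (fun i => I (fun x => v i * (k \* u i) x))); last first.
      by move=> i _; rewrite RintegralZl.
    rewrite -Rint_sum; last by move=> i; exact: int1Z.
    congr (I _); apply/funext => x; rewrite /=.
    under eq_bigr do rewrite mulrCA; rewrite -mulr_sumr /k.
    by case: ifPn; [move=> ?; rewrite mul1r ger0_norm
                   |rewrite -ltNge => ?; rewrite mulN1r ltr0_norm].
  rewrite lerBrDr; apply: le_trans (Lu v); rewrite -big_split/=.
  by apply: ler_sum => i _; rewrite /v; lra.
(* With this start vector the terms [t * I (u' i)] cancel, and thinning bounds exactly the squared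
   distance of [h']. *)
have [T mT sT] := thinning iu' (fun i => - v i + t * I (u' i)) atomless
  (introT andP (conj (ltW t0) t1)) (exprn_gt0 2 t0).
pose h' x := if x \in T then k x else h x.
have sh' : sign_fun h'.
  split; last by move=> x; rewrite /h'; case: ifP => _; [case: sk|case: sh].
  apply: measurable_fun_ifT; [|by case: sk|by case: sh].
  by apply: (measurable_fun_bool true); rewrite setTI preimage_mem_true.
have := minD _ sh'; rewrite leNgt => /negP[].
have Dh' : D h' = \sum_i (- v i + t * I (u' i) + I (\1_T \* u' i) - t * I (u' i)) ^+ 2.
  apply: eq_bigr => i _.
  have -> : I (h' \* u i) = I (h \* u i) + I (\1_T \* u' i).
    have iT : int1 (\1_T \* u' i) by exact/int1M/iu'/unit_mfun_indic.
    rewrite -(RintegralD measurableT (ih i) iT).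
    congr (I _); apply/funext => x; rewrite /h' /u' /= indicE.
    by case: (x \in T) => /=; ring.
  by rewrite /v; ring.
rewrite Dh'; apply: (le_lt_trans sT); rewrite sum_sqrD.
have -> : \sum_i (- v i) ^+ 2 = D h by apply: eq_bigr => i _; rewrite sqrrN.
under [X in _ + 2 * t * X + _]eq_bigr do rewrite mulNr.
rewrite sumrN; have mDh := minD _ sh.
have tvu' : t * m <= t * (\sum_i v i * I (u' i)).
  by rewrite ler_pM2l// (le_trans mDh).
have tB2 : t * (t * (B + 2)) <= t * m by rewrite ler_pM2l.
have tu'B : t ^+ 2 * (\sum_i I (u' i) ^+ 2) <= t ^+ 2 * B.
  by rewrite ler_pM2l// exprn_gt0.
have tm : 0 < t * m by rewrite mulr_gt0.
nra.
Qed.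

(** * Signs nearly orthogonal to a finite family *)

Definition comb n (phi : 'I_n -> K -> R) (c : 'I_n -> R) x := \sum_i c i * phi i x.

Section comb.
Variables (n : nat) (phi : 'I_n -> K -> R).
Hypothesis iphi : forall i, int1 (phi i).

Lemma int1_comb c : int1 (comb phi c).
Proof. by apply: int1_sum => i; exact: int1Z. Qed.

Lemma RintM_comb h c : unit_mfun h ->
  I (h \* comb phi c) = \sum_i c i * I (h \* phi i).
Proof.
move=> uh; have ih i : int1 (h \* phi i) by exact: int1M.
transitivity (I (fun x => \sum_i c i * (h \* phi i) x)).
  congr (I _); apply/funext => x /=; rewrite mulr_sumr.
  by apply: eq_bigr => i _; rewrite mulrCA.
rewrite Rint_sum; last by move=> i; exact: int1Z.
by apply: eq_bigr => i _; rewrite RintegralZl.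
Qed.

Lemma Rint_comb_le h c b : unit_mfun h -> (forall i, `|I (h \* phi i)| <= b) ->
  `|I (h \* comb phi c)| <= (\sum_i `|c i|) * b.
Proof.
move=> uh hb; rewrite RintM_comb// (le_trans (ler_norm_sum _ _ _))// mulr_suml.
by apply: ler_sum => i _; rewrite normrM ler_wpM2l.
Qed.

(* A linear combination killed by the weighted Gram matrix [G] vanishes almost
   everywhere, so the coefficients may be recovered from the moments with [k]
   by a generalized inverse of [G]: the [phi i] need not be independent. *)
Lemma comb_coef_bound : exists (k : 'I_n -> K -> R) (C : R),
  [/\ forall j, unit_mfun (k j), 0 <= C & forall c, exists c',
      comb phi c = comb phi c' %[ae nu] /\
      forall i, `|c' i| <= C * \sum_j `|I (k j \* comb phi c')| ].
Proof.
(* The weight makes each [rho * phi j] bounded by one, by [1 + y <= expR y]; its positivity lets a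
   weighted square detect zeros. *)
pose rho (x : K) : R := expR (- \sum_i `|phi i x|).
have mrho : measurable_fun setT rho.
  apply: measurableT_comp => //; apply: measurableT_comp => //.
  by apply: measurable_sum => i; exact/measurableT_comp/int1_measurable/iphi.
pose k j := rho \* phi j.
have uk j : unit_mfun (k j).
  split; first exact/measurable_funM/int1_measurable/iphi.
  move=> x; rewrite /k /rho /= normrM ger0_norm ?expR_ge0// expRN.
  rewrite mulrC ler_pdivrMr ?expR_gt0// mul1r.
  apply: le_trans (expR_ge1Dx _); rewrite (bigD1 j)//= addrCA lerDl.
  by rewrite addr_ge0// sumr_ge0.
pose G := \matrix_(i, j) I (k j \* phi i).
pose P := pinvmx G.
exists k, (\sum_i \sum_j `|P i j|); split => //.
  by apply: sumr_ge0 => i _; exact: sumr_ge0.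
have GE c j : ((\row_i c i) *m G) 0 j = I (k j \* comb phi c).
  by rewrite RintM_comb// mxE; apply: eq_bigr => i _; rewrite !mxE.
(* As [P] is a generalized inverse of [G], [c'] has the same moments as [c], and [c' = (c' G) P]
   bounds it by these moments. *)
move=> c; pose c' i := ((\row_i c i) *m G *m P) 0 i; exists c'.
have c'E : \row_i c' i = (\row_i c i) *m G *m P by apply/rowP => i; rewrite mxE.
have c'G : (\row_i c' i) *m G = (\row_i c i) *m G.
  by rewrite c'E mulmxKpV// submxMl.
split; last first.
  move=> i.
  have -> : c' i = \sum_j (\row_i c i *m G) 0 j * P j i by rewrite /c' mxE.
  rewrite (le_trans (ler_norm_sum _ _ _))// mulr_sumr.
  apply: ler_sum => j _; rewrite normrM mulrC -c'G GE. rewrite ler_wpM2r//.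
  rewrite (bigD1 j)//= (bigD1 i)//= -addrA lerDl addr_ge0 ?sumr_ge0// => l _.
  exact: sumr_ge0.
pose b i := c i - c' i.
have combb x : comb phi b x = comb phi c x - comb phi c' x.
  by rewrite /comb -sumrB; apply: eq_bigr => i _; rewrite mulrBl.
have Ib j : I (k j \* comb phi b) = 0.
  rewrite -GE (_ : \row_i b i = (\row_i c i) - (\row_i c' i)).
    by rewrite mulmxBl c'G subrr mxE.
  by apply/rowP => i; rewrite !mxE.
(* The integral of [q] is the quadratic form of [G] at [b], and [G] kills [b]. *)
pose q x := rho x * comb phi b x ^+ 2.
have qE : q = fun x => \sum_j b j * (k j \* comb phi b) x.
  apply/funext => x; rewrite /q expr2 mulrA mulrC {2}/comb.
  rewrite mulr_sumr mulr_sumr; apply: eq_bigr => i _.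
  by rewrite /k /=; ring.
have iq : int1 q.
  by rewrite qE; apply: int1_sum => j; exact/int1Z/int1M/int1_comb.
have Iq : I q = 0.
  rewrite qE Rint_sum; last by move=> j; exact/int1Z/int1M/int1_comb.
  rewrite big1// => j _; rewrite RintegralZl//; last exact/int1M/int1_comb.
  by rewrite Ib mulr0.
have q0 x : 0 <= q x by rewrite mulr_ge0 ?expR_ge0 ?sqr_ge0.
apply: filterS (Rint_eq0 iq q0 Iq) => x /(_ Logic.I) /eqP + _.
rewrite /q mulf_eq0 gt_eqF ?expR_gt0//= sqrf_eq0 combb subr_eq0.
by move/eqP.
Qed.

End comb.

Section signs_and_set.
Variables (n : nat) (phi : 'I_n -> K -> R).
Hypotheses (atomless : non_atomic nu) (iphi : forall i, int1 (phi i)).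

(** The target moments are the norm of [F] against [F] and zero against each [phi i]. The condition
    in [sign_fun_moments] is trivial when the coefficient of [F] is nonpositive; otherwise dividing
    by it gives the optimality of 0 for [F]. *)
Lemma sign_fun_nearly_orthogonal F (e : R) : int1 F -> 0 < e ->
  (forall c, I (fun x => `|F x|) <= I (fun x => `|F x - comb phi c x|)) ->
  exists h, [/\ sign_fun h, forall i, `|I (h \* phi i)| <= e &
    I (fun x => `|F x|) - I (h \* F) <= e].
Proof.
move=> iF e0 F0.
pose u (j : 'I_n.+1) := oapp phi F (unlift ord0 j).
pose L (j : 'I_n.+1) := if j == ord0 then I (fun x => `|F x|) else 0.
have iu j : int1 (u j) by rewrite /u; case: (unlift ord0 j).
have u0 : u ord0 = F by rewrite /u unlift_none.
have uS i : u (lift ord0 i) = phi i by rewrite /u liftK.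
have [] := @sign_fun_moments _ u L (e ^+ 2) atomless iu _ (exprn_gt0 2 e0).
  move=> v; rewrite big_ord_recl /L eqxx big1 ?addr0; last first.
    by move=> i _; rewrite mul0r.
  have iFc : int1 (fun x => F x - comb phi (fun i => - v (lift ord0 i) / v ord0) x).
    by apply: int1B => //; exact: int1_comb.
  have [v0|v0] := leP (v ord0) 0.
    rewrite (@le_trans _ _ 0) ?Rintegral_ge0//.
    by rewrite mulr_ge0_le0// Rintegral_ge0.
  apply: (@le_trans _ _ (v ord0 *
      I (fun x => `|F x - comb phi (fun i => - v (lift ord0 i) / v ord0) x|))).
    by rewrite mulrC ler_pM2l.
  rewrite -RintegralZl//; last exact: int1_norm.
  rewrite le_eqVlt; apply/orP; left; apply/eqP; apply: eq_Rintegral => x _.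
  rewrite -{1}(gtr0_norm v0) -normrM mulrBr big_ord_recl u0; congr (`|_ + _|).
  rewrite /comb mulr_sumr -sumrN; apply: eq_bigr => i _; rewrite uS.
  by field; rewrite gt_eqF.
move=> h sh hL; exists h.
have le_e j : `|L j - I (h \* u j)| <= e.
  rewrite -ler_sqr ?nnegrE ?(ltW e0)// real_normK ?num_real//.
  apply: le_trans hL; rewrite (bigD1 j)//= lerDl.
  by apply: sumr_ge0 => i _; exact: sqr_ge0.
split => //.
  by move=> i; have := le_e (lift ord0 i); rewrite /L /= uS sub0r normrN.
by have := le_e ord0; rewrite /L eqxx u0; apply: le_trans; exact: ler_norm.
Qed.

(** [S] takes a proportion [t] of finitely many integrals, up to [eta]. By [comb_coef_bound], the
    norm on [S] of a combination is then at least of order [t] times its moments, whereas the defect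
    of orthogonality is only of order [eta]. *)
Lemma signs_and_set F c0 (e : R) : int1 F -> 0 < e ->
  (forall c, I (fun x => `|F x|) <= I (fun x => `|F x - comb phi c x|)) ->
  exists h S, [/\ sign_fun h, measurable S,
    forall c, `|I (\1_(~` S) \* h \* comb phi c)| <=
              I (fun x => \1_S x * `|comb phi c x|),
    I (fun x => \1_S x * `|F x - comb phi c0 x|) <= e &
    I (fun x => `|F x|) - I (h \* F) <= e /\ `|I (h \* comb phi c0)| <= e ].
Proof.
move=> iF e0 F0.
have [k [C [uk C0 coefP]]] := comb_coef_bound iphi.
pose A := I (fun x => `|F x - comb phi c0 x|).
have A0 : 0 <= A by exact: Rintegral_ge0.
(* [t * A <= e / 2] leaves the other half of [e] to the thinning error [eta]. *)
pose t := Num.min 1 (e / (2 * (A + 1))).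
have t0 : 0 < t by rewrite lt_min ltr01 divr_gt0// mulr_gt0// ltr_wpDl.
have t1 : t <= 1 by rewrite ge_min lexx.
have tA : t * A <= e / 2.
  apply: (@le_trans _ _ (e / (2 * (A + 1)) * A)).
    by rewrite ler_wpM2r// ge_min lexx orbT.
  rewrite invfM mulrA -mulrA ler_piMr ?divr_ge0 ?(ltW e0)//.
  by rewrite ler_pdivrMl ?ltr_wpDl// mulr1 lerDl.
pose N : R := n.+1%:R.
have N0 : 0 < N by rewrite ltr0n.
have nN (x : R) : 0 <= x -> \sum_(i < n) x <= N * x.
  by move=> x0; rewrite sumr_const card_ord -[leLHS]mulr_natl ler_wpM2r// ler_nat.
pose s := \sum_i `|c0 i|.
have s0 : 0 <= s by exact: sumr_ge0.
(* The factor 4 is 3 from [left] plus 1 from the error term of [right]. *)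
pose eta := Num.min (t / (4 * N ^+ 2 * (C + 1))) (Num.min (e / 2) (e / (s + 1))).
have NC0 : 0 < 4 * N ^+ 2 * (C + 1).
  by rewrite !mulr_gt0// ?exprn_gt0// ?ltr_wpDl.
have eta0 : 0 < eta by rewrite !lt_min !divr_gt0// ltr_wpDl.
have eta_t : 4 * N ^+ 2 * C * eta <= t.
  apply: (@le_trans _ _ (4 * N ^+ 2 * (C + 1) * (t / (4 * N ^+ 2 * (C + 1))))).
    apply: ler_pM => //; [by rewrite !mulr_ge0// exprn_ge0|exact: ltW| |].
      by rewrite ler_wpM2l ?lerDl// mulr_ge0// exprn_ge0.
    by rewrite ge_min lexx.
  by rewrite mulrC divfK// gt_eqF.
have eta_e : eta <= e / 2 by rewrite !ge_min lexx orbT.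
have eta_s : s * eta <= e.
  apply: (@le_trans _ _ (s * (e / (s + 1)))).
    by rewrite ler_wpM2l// !ge_min lexx !orbT.
  by rewrite mulrCA ler_piMr ?(ltW e0)// ler_pdivrMr ?ltr_wpDl// mul1r lerDl.
have [h [sh hphi hF]] := sign_fun_nearly_orthogonal iF eta0 F0.
have uh := sign_fun_unit sh.
pose u (j : unit + ('I_n + 'I_n * 'I_n)) := match j with
  | inl _ => fun x => `|F x - comb phi c0 x|
  | inr (inl i) => h \* phi i
  | inr (inr (i, j)) => k j \* phi i
  end.
have iu j : int1 (u j).
  case: j => [_|[i|[i j]]] /=; [|exact: int1M|exact: int1M].
  by apply: int1_norm; apply: int1B => //; exact: int1_comb.
have [S mS Su] := thinning_norm iu atomless (introT andP (conj (ltW t0) t1)) eta0.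
exists h, S; split => //; last first.
- split; first by apply: (le_trans hF); lra.
  by apply: le_trans eta_s; exact: Rint_comb_le.
- have := Su (inl tt); rewrite /u -/A => /(le_trans (ler_norm _)).
  rewrite lerBlDr => /le_trans; apply; lra.
move=> c.
have uS := unit_mfun_indic mS.
have uSC := unit_mfun_indic (measurableC mS).
have [c' [cc' c'D]] := coefP c.
have icc b := int1_comb iphi b.
have cE g : unit_mfun g -> I (g \* comb phi c) = I (g \* comb phi c').
  move=> [mg _]; apply: Rint_ae_eq.
  - exact/measurable_funM/int1_measurable/icc.
  - exact/measurable_funM/int1_measurable/icc.
  - by apply: filterS cc' => x /[apply] /= ->.
rewrite cE; last exact: unit_mfunM.
have -> : I (fun x => \1_S x * `|comb phi c x|) = I (fun x => \1_S x * `|comb phi c' x|).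
  apply: Rint_ae_eq.
  - exact/int1_measurable/int1M/int1_norm/icc.
  - exact/int1_measurable/int1M/int1_norm/icc.
  - by apply: filterS cc' => x /[apply] /= ->.
set X := (X in _ <= X); set D := \sum_j _ in c'D.
have D0 : 0 <= D by exact: sumr_ge0.
have sc' : \sum_i `|c' i| <= N * (C * D).
  by apply: le_trans (nN _ (mulr_ge0 C0 D0)); exact: ler_sum.
(* One [eta] for the near orthogonality of [h], one for thinning, and one bounding [t] times the
   first. *)
have left : `|I (\1_(~` S) \* h \* comb phi c')| <= N * (C * D) * (3 * eta).
  apply: (@le_trans _ _ ((\sum_i `|c' i|) * (3 * eta))); last first.
    by rewrite ler_wpM2r// mulr_ge0// ltW.
  apply: Rint_comb_le => //; first exact: unit_mfunM.
  move=> i.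
  have -> : I (\1_(~` S) \* h \* phi i) = I (h \* phi i) - I (\1_S \* (h \* phi i)).
    have ihi : int1 (h \* phi i) by exact: int1M.
    have iShi : int1 (\1_S \* (h \* phi i)) by exact: int1M.
    rewrite -(RintegralB measurableT ihi iShi); apply: eq_Rintegral => x _ /=.
    by rewrite !indicE in_setC; case: (x \in S) => /=; ring.
  have := Su (inr (inl i)); rewrite /u /= => Si; have hi := hphi i.
  have thi : `|t * I (h \* phi i)| <= eta.
    by rewrite normrM (gtr0_norm t0) (le_trans _ hi)// ler_piMl.
  move: Si hi thi; rewrite !ler_norml; lra.
have right : t * D <= N * X + N * (N * (C * D) * eta).
  have XE j : `|t * I (k j \* comb phi c')| <= X + N * (C * D) * eta.
    have -> : t * I (k j \* comb phi c') = I (\1_S \* k j \* comb phi c') -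
        \sum_i c' i * (I (\1_S \* (k j \* phi i)) - t * I (k j \* phi i)).
      rewrite !RintM_comb//; last exact: unit_mfunM.
      under [X in _ - X]eq_bigr do rewrite mulrBr.
      rewrite sumrB mulr_sumr opprB addrC.
      rewrite (_ : \sum_i c' i * I (\1_S \* k j \* phi i) =
                   \sum_i c' i * I (\1_S \* (k j \* phi i))).
        by rewrite subrK; apply: eq_bigr => i _; rewrite mulrCA.
      apply: eq_bigr => i _; congr (_ * I _); apply/funext => x /=.
      by rewrite mulrA.
    apply: (le_trans (ler_normB _ _)); apply: lerD.
      rewrite (_ : \1_S \* k j \* comb phi c' = k j \* (\1_S \* comb phi c')); last first.
        by apply/funext => x /=; ring.
      have iSc : int1 (\1_S \* comb phi c') by exact: int1M.
      apply: (le_trans (Rint_norm_le (uk j) iSc)).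
      rewrite le_eqVlt; apply/orP; left; apply/eqP; apply: eq_Rintegral => x _ /=.
      by rewrite normrM indicE ger0_norm.
    apply: (le_trans (ler_norm_sum _ _ _)).
    apply: (@le_trans _ _ ((\sum_i `|c' i|) * eta)); last by rewrite ler_wpM2r// ltW.
    rewrite mulr_suml; apply: ler_sum => i _; rewrite normrM ler_wpM2l//.
    exact: (Su (inr (inr (i, j)))).
  rewrite -mulrDr /D mulr_sumr.
  under eq_bigr do rewrite -{1}(gtr0_norm t0) -normrM.
  have XD0 : 0 <= X + N * (C * D) * eta.
    apply: addr_ge0.
      by apply: Rintegral_ge0 => x _; rewrite mulr_ge0// indicE.
    exact: mulr_ge0 (mulr_ge0 (ltW N0) (mulr_ge0 C0 D0)) (ltW eta0).
  by apply: le_trans (nN _ XD0); apply: ler_sum.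
(* With [Q = N ^+ 2 * C * eta * D], the chain [4 * Q <= t * D <= N * X + Q] gives [3 * Q <= N * X],
   the desired bound multiplied by [N]. *)
apply: (le_trans left); rewrite -(ler_pM2l N0).
have : 4 * N ^+ 2 * C * eta * D <= t * D by rewrite ler_wpM2r.
have -> : N * (N * (C * D) * (3 * eta)) = 3 * (N ^+ 2 * C * eta * D) by ring.
have -> : 4 * N ^+ 2 * C * eta * D = 4 * (N ^+ 2 * C * eta * D) by ring.
move: right; have -> : N * (N * (C * D) * eta) = N ^+ 2 * C * eta * D by ring.
lra.
Qed.

End signs_and_set.

(** * Best approximation *)

Section norm1.
Implicit Types f g m p : L1 nu.

Lemma L1_int1 f : int1 (f : K -> R).
Proof. by apply/Lfun1_integrable; exact: LfunP. Qed.

Lemma int1_L1 u : int1 u -> exists g, (g : K -> R) = u.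
Proof. by move=> /Lfun1_integrable uL; exists (Lfun_Sub (lexx 1%E) uL). Qed.

Lemma norm1E f : norm1 f = I (fun x => `|f x|).
Proof. by rewrite /norm1 Lnorm1. Qed.

Lemma norm1BE f g : norm1 (f - g) = I (fun x => `|f x - g x|).
Proof. by rewrite norm1E. Qed.

Lemma L1_sumZE n (phi : 'I_n -> L1 nu) (c : 'I_n -> R) :
  (\sum_(i < n) c i *: phi i : L1 nu) = comb phi c :> (K -> R).
Proof.
apply/funext => x; rewrite /comb.
elim/big_rec2: _ => // i y z _ <-.
by [].
Qed.

Lemma norm1_ge0 f : 0 <= norm1 f.
Proof. by rewrite norm1E Rintegral_ge0. Qed.

Lemma norm1_distC f g : norm1 (f - g) = norm1 (g - f).
Proof. by rewrite !norm1BE; apply: eq_Rintegral => x _; rewrite distrC. Qed.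

Lemma norm1_dist_triangle f g m :
  norm1 (f - m) <= norm1 (f - g) + norm1 (g - m).
Proof.
have := ler_LnormD (f - g) (g - m).
by rewrite addrA subrK.
Qed.

Lemma norm1_dist_ae f g m : f = g %[ae nu] -> norm1 (f - m) = norm1 (g - m).
Proof.
move=> fg; rewrite !norm1BE; apply: Rint_ae_eq.
- exact/int1_measurable/int1_norm/int1B/L1_int1/L1_int1.
- exact/int1_measurable/int1_norm/int1B/L1_int1/L1_int1.
- by apply: filterS fg => x /[apply] ->.
Qed.

Lemma norm1_dist_eq0 f g : norm1 (f - g) = 0 -> f = g %[ae nu].
Proof.
move=> /fine_Lnormr_eq0; apply: filterS => x /[apply] /eqP.
by rewrite subr_eq0 => /eqP.
Qed.

End norm1.

(** The term [e] absorbs the defects of [h] and the change made on [S]. The optimality of [m] for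
    [g] is nevertheless exact: off [S] the failure of orthogonality is at most what any competitor
    loses on [S], where [g = m]. *)
Lemma best_approximant_near (M : {pred L1 nu}) f p m (e : R) :
  non_atomic nu -> fin_dim_subspace M -> best_approximant M f p -> m \in M ->
  0 < e -> exists g, best_approximant M g m /\
    2 * norm1 (f - g) <= norm1 (f - m) - norm1 (f - p) + e.
Proof.
move=> atomless [[M0 Mlin] [n [phi [phiM Mphi]]]] [pM pbest] mM e0.
have MD a b : a \in M -> b \in M -> a + b \in M.
  by move=> aM bM; rewrite -[a]scale1r; exact: Mlin.
have MZ (c : R) a : a \in M -> c *: a \in M.
  by move=> aM; rewrite -[_ *: _]addr0; exact: Mlin.
have MB a b : a \in M -> b \in M -> a - b \in M.
  by move=> aM bM; rewrite -scaleN1r; apply: MD => //; exact: MZ.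
have Msum c : (\sum_(i < n) c i *: phi i : L1 nu) \in M.
  by elim/big_ind: _ => // i _; exact/MZ.
have iphi i : int1 (phi i : K -> R) by exact: L1_int1.
have combE r : r \in M -> exists c, (r : K -> R) = comb phi c %[ae nu].
  by move=> /Mphi[c]; rewrite L1_sumZE; exists c.
have [c0 c0E] := combE _ (MB _ _ mM pM).
pose F x := f x - p x.
have iF : int1 F by exact: (L1_int1 (f - p)).
have F0 c : I (fun x => `|F x|) <= I (fun x => `|F x - comb phi c x|).
  have := pbest _ (MD _ _ pM (Msum c)); rewrite !norm1BE => /le_trans; apply.
  rewrite le_eqVlt; apply/orP; left; apply/eqP; apply: eq_Rintegral => x _.
  by rewrite -L1_sumZE /F /= opprD addrA.
(* The error on [S] counts twice, and the two defects of [h] once each. *)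
have e4 : 0 < e / 4 by rewrite divr_gt0.
have [h [S [sh mS hS SF [hF hc0]]]] := signs_and_set atomless iphi c0 iF e4 F0.
have [mh h1] := sh.
have iq : int1 (fun x => m x - p x) by exact: (L1_int1 (m - p)).
have imf : int1 (fun x => m x - f x) by exact: (L1_int1 (m - f)).
pose B := S `|` [set x | h x * (f x - m x) < 0].
have mB : measurable B.
  apply: measurableU => //; rewrite -[X in measurable X]setTI.
  apply: measurable_fun_ltr => //; apply: measurable_funM => //.
  exact: (int1_measurable (L1_int1 (f - m))).
have uB := unit_mfun_indic mB; have uS := unit_mfun_indic mS.
have uSC := unit_mfun_indic (measurableC mS).
have uh := sign_fun_unit sh.
have [g gE] := int1_L1 (int1D (L1_int1 f) (int1M uB imf)).
have gB x : B x -> g x = m x.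
  by move=> Bx; rewrite gE /= indicE mem_set// mul1r addrC subrK.
have gNB x : ~ B x -> g x = f x.
  by move=> Bx; rewrite gE /= indicE memNset// mul0r addr0.
have habs x y : h x * y <= `|y|.
  by apply: (le_trans (ler_norm _)); rewrite normrM ler_piMl//; case: uh.
exists g; split.
  split => // m' m'M; have [c cE] := combE _ (MB _ _ mM m'M).
  have := hS c; rewrite ler_norml => /andP[+ _].
  have -> : I (\1_(~` S) \* h \* comb phi c) = I (\1_(~` S) \* h \* (m - m' : L1 nu)).
    apply: Rint_ae_eq.
    - exact/int1_measurable/int1M/int1_comb/iphi/unit_mfunM.
    - exact/int1_measurable/int1M/L1_int1/unit_mfunM.
    - by apply: filterS cE => x /[apply] /= ->.
  have -> : I (fun x => \1_S x * `|comb phi c x|) = I (fun x => \1_S x * `|m x - m' x|).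
    apply: Rint_ae_eq.
    - exact/int1_measurable/int1M/int1_norm/int1_comb/iphi.
    - exact/int1_measurable/int1M/int1_norm/(L1_int1 (m - m')).
    - by apply: filterS cE => x /[apply] /= <-.
  set X1 := I _; set X2 := I _ => X12.
  have igm : int1 (fun x => `|g x - m x|) by exact/int1_norm/(L1_int1 (g - m)).
  have igm' : int1 (fun x => `|g x - m' x|) by exact/int1_norm/(L1_int1 (g - m')).
  have i1 : int1 (\1_(~` S) \* h \* (m - m' : L1 nu)).
    exact/int1M/L1_int1/unit_mfunM.
  have i2 : int1 (fun x => \1_S x * `|m x - m' x|).
    exact/int1M/int1_norm/(L1_int1 (m - m')).
  rewrite !norm1BE.
  (* A pointwise comparison. On [S], [g = m]. Off [S], [|g - m| = h (g - m)], so [|g - m'| >= h (g -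
     m') = |g - m| + h (m - m')]. *)
  suff : I (fun x => `|g x - m x|) + X1 + X2 <= I (fun x => `|g x - m' x|) by lra.
  have <- : I (((fun x => `|g x - m x|) \+ (fun x => \1_S x * `|m x - m' x|)) \+
      (\1_(~` S) \* h \* (m - m' : L1 nu))) = I (fun x => `|g x - m x|) + X1 + X2.
    apply: etrans (RintegralD measurableT (int1D igm i2) i1) _.
    by congr (_ + _); exact: (RintegralD measurableT igm i2).
  apply: le_Rintegral => //; first exact: int1D (int1D igm i2) i1.
  move=> x _; rewrite /= !indicE in_setC; have [/set_mem xS|/negP xS] := boolP (x \in S).
    have -> : g x = m x by apply: gB; left.
    by rewrite subrr normr0 add0r mul1r mul0r mul0r addr0.
  rewrite mul0r addr0 mul1r.
  have -> : `|g x - m x| = h x * (g x - m x).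
    have [hx|hx] := ltP (h x * (f x - m x)) 0.
      by rewrite gB ?subrr ?normr0 ?mulr0//; right.
    rewrite gNB => [|[/mem_set//|/=]]; last by rewrite ltNge hx.
    by rewrite -[RHS]ger0_norm// normrM; case: (h1 x) => ->; rewrite ?normrN normr1 mul1r.
  by rewrite -mulrDr addrA subrK; exact: habs.
have ifm : int1 (fun x => f x - m x) by exact: (L1_int1 (f - m)).
have iSfm : int1 (fun x => \1_S x * `|f x - m x|) by exact/int1M/int1_norm.
have ihfm : int1 (h \* (fun x => f x - m x)) by exact: int1M.
have ihF : int1 (h \* F) by exact: int1M.
have ihq : int1 (h \* (fun x => m x - p x)) by exact: int1M.
have E1 : I (fun x => \1_S x * `|F x - comb phi c0 x|) =
    I (fun x => \1_S x * `|f x - m x|).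
  apply: Rint_ae_eq.
  - exact/int1_measurable/int1M/int1_norm/(int1B iF (int1_comb iphi c0)).
  - exact: (int1_measurable iSfm).
  - by apply: filterS c0E => x /[apply] /= <-; rewrite /F /= opprB addrA subrK.
have E2 : I (h \* comb phi c0) = I (h \* (fun x => m x - p x)).
  apply: Rint_ae_eq.
  - exact/int1_measurable/int1M/int1_comb.
  - exact: (int1_measurable ihq).
  - by apply: filterS c0E => x /[apply] /= <-.
have E3 : I (h \* (fun x => f x - m x)) = I (h \* F) - I (h \* (fun x => m x - p x)).
  rewrite -[RHS](RintegralB measurableT ihF ihq); apply: eq_Rintegral => x _.
  by rewrite /F /=; ring.
rewrite E1 in SF; rewrite E2 ler_norml in hc0; case/andP: hc0 => _ hc0.
rewrite !norm1BE -RintegralZl//; last exact/int1_norm/(L1_int1 (f - g)).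
(* Off [S] the integrands of both sides agree, since [h] takes only the values 1 and -1; on [S] the
   first term on the right suffices. *)
suff : I (fun x => 2 * `|f x - g x|) <= 2 * I (fun x => \1_S x * `|f x - m x|) +
    (I (fun x => `|f x - m x|) - I (h \* (fun x => f x - m x))).
  by rewrite /F /= in hF E3 *; lra.
have i2S := int1Z 2 iSfm; have iah := int1B (int1_norm ifm) ihfm.
have <- : I ((fun x => 2 * (\1_S x * `|f x - m x|)) \+
    ((fun x => `|f x - m x|) \- (h \* (fun x => f x - m x)))) =
    2 * I (fun x => \1_S x * `|f x - m x|) +
    (I (fun x => `|f x - m x|) - I (h \* (fun x => f x - m x))).
  rewrite -RintegralZl// -[X in _ + X](RintegralB measurableT (int1_norm ifm) ihfm).
  exact: (RintegralD measurableT i2S iah).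
apply: le_Rintegral => //; [exact/int1Z/int1_norm/(L1_int1 (f - g))|exact: int1D|].
move=> x _; have := habs x (f x - m x) => /=.
have [Sx|nSx] := pselect (S x).
  by rewrite gB ?indicE ?mem_set//=; [lra|left].
rewrite indicE memNset//= => hx.
have [hx0|hx0] := ltP (h x * (f x - m x)) 0; last first.
  by rewrite gNB ?subrr ?normr0; [lra|case=> //=; rewrite ltNge hx0].
rewrite gB; last by right.
have : `|f x - m x| = - (h x * (f x - m x)).
  by rewrite -[RHS]gtr0_norm ?oppr_gt0// normrN normrM; case: (h1 x) => ->;
    rewrite ?normrN normr1 mul1r.
lra.
Qed.

(** * Comparison of the two kinds of constants, and their optimal values *)

Section constants.
Variables (M : {pred L1 nu}) (f : L1 nu).
Implicit Types g m p q : L1 nu.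

Lemma strong_uniqueness_unique p (c : R) : p \in M ->
  strong_uniqueness_bound M f p c -> unique_best_approximant M f p.
Proof.
move=> pM [c0 pc]; split.
  split => // m mM; rewrite -subr_ge0; apply: le_trans (pc m mM).
  by rewrite mulr_ge0 ?norm1_ge0 ?ltW.
move=> m [mM mbest]; apply: norm1_dist_eq0; apply/eqP.
rewrite eq_le norm1_ge0 andbT -(pmulr_rle0 _ c0).
by apply: (le_trans (pc m mM)); rewrite subr_le0 mbest.
Qed.

(** As [q] is best for [g], [||f - q|| - ||f - p||] is at most [||f - g|| + ||g - p|| - ||f - p||],
    hence at most [2 ||f - g||]. *)
Lemma strong_uniqueness_lipschitz p (c : R) :
  strong_uniqueness_bound M f p c -> p \in M -> lipschitz_bound M f p (2 / c).
Proof.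
move=> [c0 pc] pM; split; first by rewrite divr_gt0.
move=> g q [qM qbest]; rewrite (norm1_distC p) mulrAC ler_pdivlMr// mulrC.
apply: (le_trans (pc q qM)).
have := norm1_dist_triangle f g q; have := norm1_dist_triangle g f p.
by have := qbest p pM; rewrite (norm1_distC g f); lra.
Qed.

(** The Lipschitz bound is applied to a [g] with the given [m] as a best approximant, whose distance
    to [f] is controlled up to an arbitrary [e]. *)
Lemma lipschitz_strong_uniqueness p (c : R) :
  non_atomic nu -> fin_dim_subspace M -> best_approximant M f p ->
  lipschitz_bound M f p c -> strong_uniqueness_bound M f p (2 / c).
Proof.
move=> atomless Mfin pbest [c0 pc]; split; first by rewrite divr_gt0.
move=> m mM; apply/ler_addgt0Pr => e e0.
have [g [gbest gm]] := best_approximant_near atomless Mfin pbest mM e0.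
have := pc g m gbest; rewrite (norm1_distC p) => mp.
rewrite mulrAC ler_pdivrMr//; apply: le_trans (ler_wpM2r (ltW c0) gm).
by rewrite -mulrA ler_pM2l// mulrC.
Qed.

Lemma strong_uniqueness_bound_ae p q (c : R) : p = q %[ae nu] ->
  strong_uniqueness_bound M f p c -> strong_uniqueness_bound M f q c.
Proof.
move=> pq [c0 pc]; split => // m mM; have := pc m mM.
by rewrite ![norm1 (_ - p)]norm1_distC !(norm1_dist_ae _ pq) ![norm1 (q - _)]norm1_distC.
Qed.

(** The bound is tested at [m + p] with [m] nonzero, against the triangle inequality. This gives the
    set of constants a supremum. *)
Lemma strong_uniqueness_le1 p (c : R) : submod_closed M -> nonzero_subspace M ->
  p \in M -> strong_uniqueness_bound M f p c -> c <= 1.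
Proof.
move=> [M0 Mlin] [m [mM m0]] pM [c0 pc].
have pmM : m + p \in M by rewrite -[m]scale1r; exact: Mlin.
have mE : norm1 (m + p - p) = norm1 (m - 0) by rewrite addrK subr0.
have mgt0 : 0 < norm1 (m - 0).
  by rewrite lt0r norm1_ge0 andbT; apply/eqP => /norm1_dist_eq0.
rewrite -(ler_pM2r mgt0) mul1r; have := pc _ pmM; rewrite mE => /le_trans; apply.
have := norm1_dist_triangle f p (m + p); rewrite (norm1_distC p) mE; lra.
Qed.

(** All witnesses agree almost everywhere, so every constant is valid for the single [p], and the
    defining inequality passes to the supremum. *)
Lemma optimal_strong_uniqueness p (c : R) :
  submod_closed M -> nonzero_subspace M -> p \in M ->
  strong_uniqueness_bound M f p c ->
  optimal_strong_uniqueness_constant M f (sup (strong_uniqueness_constants M f)).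
Proof.
move=> Msub Mneq0 pM pc.
set E := strong_uniqueness_constants M f.
have uE : ubound E 1.
  by move=> b [q [qM qb]]; exact: strong_uniqueness_le1 Msub Mneq0 qM qb.
have Ec : E c by exists p.
have supE : ubound E (sup E) by apply: ub_le_sup; exists 1.
have [pbest puniq] := strong_uniqueness_unique pM pc.
split => //; exists p; split => //; split.
  by apply: lt_le_trans (supE _ Ec); case: pc.
move=> m mM; have := norm1_ge0 (m - p); rewrite le_eqVlt => /predU1P[<-|mp0].
  by rewrite mulr0 subr_ge0; exact: pbest.2.
rewrite -ler_pdivlMr//; apply: ge_sup; first by exists c.
move=> b [q [qM qb]]; rewrite ler_pdivlMr//.
have qp := puniq _ (strong_uniqueness_unique qM qb).1.
by have [_] := strong_uniqueness_bound_ae qp qb; exact.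
Qed.

Lemma lipschitz_bound_ae p q (c : R) : p = q %[ae nu] ->
  lipschitz_bound M f p c -> lipschitz_bound M f q c.
Proof. by move=> pq [c0 pc]; split => // g m /pc; rewrite (norm1_dist_ae _ pq). Qed.

(** The inequality passes to the infimum, which the lower bound [b] keeps positive, as
    [lipschitz_bound] demands. *)
Lemma optimal_lipschitz p (b c : R) : unique_best_approximant M f p ->
  lipschitz_bound M f p c -> 0 < b -> lbound (local_lipschitz_constants M f) b ->
  optimal_local_lipschitz_constant M f (inf (local_lipschitz_constants M f)).
Proof.
move=> up pc b0; set E := local_lipschitz_constants M f => Eb.
have Ec : E c by exists p.
have hE : has_lbound E by exists b.
split; last by move=> s Es; exact: ge_inf.
have infE : b <= inf E by apply: lb_le_inf => //; exists c.
exists p; split => //; split; first exact: lt_le_trans infE.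
move=> g q gq; have := norm1_ge0 (f - g); rewrite le_eqVlt => /predU1P[fg|fg].
  by have := pc.2 g q gq; rewrite -fg !mulr0.
rewrite -ler_pdivrMr//; apply: lb_le_inf; first by exists c.
move=> s [p' [[p'best _] p's]]; rewrite ler_pdivrMr//.
by have [_] := lipschitz_bound_ae (up.2 _ p'best) p's; exact.
Qed.

End constants.

End L1_best_approximation.

Theorem theorem5p6 (d : measure_display) (K : measurableType d) (R : realType)
    (nu : {measure set K -> \bar R}) (nu_non_atomic : non_atomic nu)
    (M : {pred L1 nu}) (M_fin_dim : fin_dim_subspace M)
    (M_neq0 : nonzero_subspace M) (f : L1 nu) :
  ((exists m0 : L1 nu, strongly_unique_best_approximant M f m0) <->
     locally_lipschitz_at M f) /\
  ((exists m0 : L1 nu, strongly_unique_best_approximant M f m0) ->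
     exists gamma sigma : R,
       [/\ optimal_strong_uniqueness_constant M f gamma,
           optimal_local_lipschitz_constant M f sigma,
           1 / gamma <= sigma &
           sigma <= 2 / gamma]).
Proof.
have Msub := M_fin_dim.1; split; first split.
- move=> [p [pM [c pc]]]; exists p; split.
    exact: strong_uniqueness_unique pc.
  by exists (2 / c); exact: strong_uniqueness_lipschitz.
- move=> [p [[pbest _] [c pc]]]; exists p; split; first by case: pbest.
  by exists (2 / c); exact: lipschitz_strong_uniqueness.
move=> [p [pM [c pc]]].
have gammaP := optimal_strong_uniqueness Msub M_neq0 pM pc.
set gamma := sup _ in gammaP.
have gamma0 : 0 < gamma by case: gammaP => [[q [_ []]]].
(* A Lipschitz constant [s] yields the strong uniqueness constant [2 / s], so [2 / s <= gamma]. This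
   is twice the lower bound asked for; with the upper bound it makes the optimal Lipschitz constant
   equal to [2 / gamma]. *)
have lip_ge : lbound (local_lipschitz_constants M f) (2 / gamma).
  move=> s [q [[qbest _] qs]]; have [s0 _] := qs.
  rewrite ler_pdivrMr// mulrC -ler_pdivrMr//; apply: gammaP.2; exists q; split.
    by case: qbest.
  exact: lipschitz_strong_uniqueness.
have up := strong_uniqueness_unique pM pc.
have sigmaP := optimal_lipschitz up (strong_uniqueness_lipschitz pc pM)
  (divr_gt0 (ltr0Sn R 1) gamma0) lip_ge.
exists gamma, (inf (local_lipschitz_constants M f)); split => //.
- apply: le_trans (lip_ge _ sigmaP.1); rewrite ler_pM2r ?invr_gt0//.
  by rewrite ler1n.
- apply: sigmaP.2; have [[q [qM qgamma]] _] := gammaP.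
  exists q; split; first exact: strong_uniqueness_unique qgamma.
  exact: strong_uniqueness_lipschitz.
Qed.
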